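(* Let $\Delta^l=\{\alpha\in\mathbb{R}^l:\sum_{i=1}^l\alpha_i=1,\ \alpha_i\ge 0\}$, and let $A(\alpha)\in\mathbb{R}^{n\times n}$, $B_1(\alpha)\in\mathbb{R}^{n\times p}$, $B_2(\alpha)\in\mathbb{R}^{n\times m}$, $C_1(\alpha)\in\mathbb{R}^{q\times n}$, $D_{11}(\alpha)\in\mathbb{R}^{q\times p}$, $D_{12}(\alpha)\in\mathbb{R}^{q\times m}$ be homogeneous matrix-valued polynomials in $\alpha\in\mathbb{R}^l$. Consider the plant with state $x(t)\in\mathbb{R}^n$, control $u(t)\in\mathbb{R}^m$, external input $\omega(t)\in\mathbb{R}^p$, external output $z(t)\in\mathbb{R}^q$, and parameter $\alpha\in\Delta^l$, $$\dot x=A(\alpha)x+B_1(\alpha)\omega+B_2(\alpha)u,\qquad z=C_1(\alpha)x+D_{11}(\alpha)\omega+D_{12}(\alpha)u,$$ with measured output $y=C_2(\alpha)x+D_{21}(\alpha)\omega$, where $C_2,D_{21}$ are matrix-valued polynomials of compatible sizes. Suppose $(A(\alpha),B_2(\alpha))$ is stabilizable and $(C_2(\alpha),A(\alpha))$ is detectable for all $\alpha\in\Delta^l$. Let $\gamma>0$, and let $$P(\alpha)=\sum_{h\in I_{d_p}}P_h\alpha_1^{h_1}\cdots\alpha_l^{h_l},\quad P_h\in\mathbb{S}^n,\qquad R(\alpha)=\sum_{h\in I_{d_r}}R_h\alpha_1^{h_1}\cdots\alpha_l^{h_l},\quad R_h\in\mathbb{R}^{m\times n},$$ be homogeneous matrix-valued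 polynomials of degrees $d_p$ and $d_r$. Let $F(\alpha)$ be the symmetric matrix-valued polynomial $$F(\alpha)=\begin{bmatrix}-P & 0&0&0\\ 0& AP+B_2R+PA^T+R^TB_2^T & B_1 & (C_1P+D_{12}R)^T\\ 0& B_1^T&0&D_{11}^T\\ 0& C_1P+D_{12}R& D_{11}&0\end{bmatrix}$$ (all entries evaluated at $\alpha$), homogenized to a homogeneous matrix-valued polynomial of degree $d_f$. Suppose there exists an integer $e\ge 0$ such that every matrix coefficient of the homogeneous polynomial $$\Big(\sum_{i=1}^l\alpha_i\Big)^e\left(F(\alpha)-\gamma\begin{bmatrix}0&0&0&0\\0&0&0&0\\0&0&I&0\\0&0&0&I\end{bmatrix}\Big(\sum_{i=1}^l\alpha_i\Big)^{d_f}\right)$$ (that is, the coefficient of $\alpha^{g}$ for every $g\in I_{d_f+e}$) is negative definite. Then for all $\alpha\in\Delta^l$, $$F(\alpha)-\gamma\begin{bmatrix}0&0&0&0\\0&0&0&0\\0&0&I&0\\0&0&0&I\end{bmatrix}<0,$$ and $K(\alpha)=R(\alpha)P(\alpha)^{-1}$ is a static state-feedback gain (with $u=K(\alpha)x$) satisfying $$\|S(G,K(\alpha))\|_{H_\infty}\le\gamma\quad\text{for all }\alpha\in\Delta^l.$$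
   Context: $\mathbb{S}^n$ denotes the real symmetric $n\times n$ matrices; for symmetric matrices, $<0$ means negative definite. For $d\in\mathbb{N}$, $I_d=\{h\in\mathbb{N}^l:\sum_{i=1}^l h_i=d\}$ (with $0\in\mathbb{N}$), and $\alpha^h=\alpha_1^{h_1}\cdots\alpha_l^{h_l}$. Homogenization: a matrix-valued polynomial whose monomials have degree at most $d_f$ is homogenized to degree $d_f$ by multiplying each monomial $\alpha^h$ by $(\sum_{i=1}^l\alpha_i)^{d_f-\|h\|_1}$, where $\|h\|_1=\sum_i h_i$; this does not change its values on $\Delta^l$. Here $d_f$ is the degree of $F$, i.e. the maximal degree of its monomials. The matrix coefficients of a homogeneous matrix-valued polynomial of degree $d$ are the matrices $M_g$, $g\in I_d$, in its expansion $\sum_{g\in I_d}M_g\alpha^g$. $G$ denotes the plant and $S(G,K(\alpha))$ denotes, for a fixed (time-invariant) value of $\alpha$, the closed-loop map from $\omega$ to $z$ under full-state feedback $u=K(\alpha)x$, i.e. the linear time-invariant system $\dot x=(A+B_2K)x+B_1\omega$, $z=(C_1+D_{12}K)x+D_{11}\omega$. The bound $\|S(G,K(\alpha))\|_{H_\infty}\le\gamma$ means that $A+B_2K$ is Hurwitz and $\sup_{\nu\in\mathbb{R}}\bar\sigma\big((C_1+D_{12}K)(i\nu I-A-B_2K)^{-1}B_1+D_{11}\big)\le\gamma$, where $\bar\sigma$ is the largest singular value. *)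

(* Defs.v *)
From HB Require Import structures.
From mathcomp Require Import all_boot all_order all_algebra.
From mathcomp Require Import complex mpoly.
From mathcomp Require Import classical_sets reals constructive_ereal ereal.

Set Implicit Arguments.
Unset Strict Implicit.
Unset Printing Implicit Defensive.

Import Order.TTheory GRing.Theory Num.Theory.

Local Open Scope ring_scope.
Local Open Scope complex_scope.
Local Open Scope sesquilinear_scope.
Local Open Scope classical_set_scope.

(** * Matrix-valued polynomials in [l] real variables *)

Definition mxeval (R : realType) l m n (a : 'I_l -> R)
    (M : 'M[{mpoly R[l]}]_(m, n)) : 'M[R]_(m, n) :=
  map_mx (meval a) M.

Definition mxcoeff (R : realType) l m n (h : 'X_{1..l})
    (M : 'M[{mpoly R[l]}]_(m, n)) : 'M[R]_(m, n) :=
  map_mx (mcoeff h) M.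

(* All entries are homogeneous of the same degree [d]; a zero entry is
   homogeneous of every degree. *)
Definition mxdhomog (R : realType) l m n (d : nat)
    (M : 'M[{mpoly R[l]}]_(m, n)) : Prop :=
  forall i j, M i j \is d.-homog.

Definition mxhomog (R : realType) l m n (M : 'M[{mpoly R[l]}]_(m, n)) : Prop :=
  exists d, mxdhomog d M.

(* [msize p] is one more than the total degree of [p], and [msize 0 = 0]; the
   degree of the zero matrix is 0 by convention. *)
Definition mxdeg (R : realType) l m n (M : 'M[{mpoly R[l]}]_(m, n)) : nat :=
  \max_(i < m) \max_(j < n) (msize (M i j)).-1.

Definition sumX (R : realType) l : {mpoly R[l]} := \sum_(i < l) 'X_i.

(* Only meaningful when every monomial of [p] has degree at most [d], since
   [d - mdeg h] is a truncated subtraction. *)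
Definition homogenize (R : realType) l (d : nat) (p : {mpoly R[l]}) :
    {mpoly R[l]} :=
  \sum_(h <- msupp p) p@_h *: ('X_[h] * sumX R l ^+ (d - mdeg h)).

Definition mxhomogenize (R : realType) l m n (d : nat)
    (M : 'M[{mpoly R[l]}]_(m, n)) : 'M[{mpoly R[l]}]_(m, n) :=
  map_mx (homogenize d) M.

Definition simplex (R : realType) l : set ('I_l -> R) :=
  [set a | \sum_(i < l) a i = 1 /\ forall i, 0 <= a i].

Definition negdef (R : realType) n (M : 'M[R]_n) : Prop :=
  M^T = M /\ forall x : 'cV[R]_n, x != 0 -> (x^T *m M *m x) 0 0 < 0.

(** * Linear time-invariant systems *)

Definition mxC (R : realType) m n (M : 'M[R]_(m, n)) : 'M[R[i]]_(m, n) :=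
  map_mx (real_complex R) M.

Definition hurwitz (R : realType) n (A : 'M[R]_n) : Prop :=
  forall z : R[i], eigenvalue (mxC A) z -> complex.Re z < 0.

Definition stabilizable (R : realType) n m (A : 'M[R]_n) (B : 'M[R]_(n, m)) :
    Prop :=
  exists K : 'M[R]_(m, n), hurwitz (A + B *m K).

Definition detectable (R : realType) n r (C : 'M[R]_(r, n)) (A : 'M[R]_n) :
    Prop :=
  exists L : 'M[R]_(n, r), hurwitz (A + L *m C).

(* The system x' = A x + B w, z = C x + D w. *)
Record lti (R : realType) (n p q : nat) := LTI {
  ltiA : 'M[R]_n;
  ltiB : 'M[R]_(n, p);
  ltiC : 'M[R]_(q, n);
  ltiD : 'M[R]_(q, p)
}.

(* The system from w to z obtained from x' = A x + B1 w + B2 u,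
   z = C1 x + D11 w + D12 u with u = K x. *)
Definition closed_loop (R : realType) n m p q (A : 'M[R]_n)
    (B1 : 'M[R]_(n, p)) (B2 : 'M[R]_(n, m)) (C1 : 'M[R]_(q, n))
    (D11 : 'M[R]_(q, p)) (D12 : 'M[R]_(q, m)) (K : 'M[R]_(m, n)) : lti R n p q :=
  LTI (A + B2 *m K) B1 (C1 + D12 *m K) D11.

(* [invmx] returns its argument on singular matrices, so this is the transfer
   matrix only where [s] is not an eigenvalue of [ltiA S]. *)
Definition transfer (R : realType) n p q (S : lti R n p q) (s : R[i]) :
    'M[R[i]]_(q, p) :=
  mxC (ltiC S) *m invmx (s%:M - mxC (ltiA S)) *m mxC (ltiB S) + mxC (ltiD S).

Definition singular_value (R : realType) q p (M : 'M[R[i]]_(q, p)) (s : R) :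
    Prop :=
  0 <= s /\ eigenvalue (M^t* *m M) (s ^+ 2)%:C.

(* The set of singular values is finite, so this supremum is its maximum; it is
   0 when [p = 0], as [sup set0 = 0]. *)
Definition sigma_max (R : realType) q p (M : 'M[R[i]]_(q, p)) : R :=
  sup [set s : R | singular_value M s].

(* The supremum over the frequencies is taken in the extended reals: the real
   [sup] of an unbounded set is 0. *)
Definition hinf_le (R : realType) n p q (S : lti R n p q) (gamma : R) : Prop :=
  hurwitz (ltiA S) /\
  (ereal_sup (range (fun nu : R => (sigma_max (transfer S (0 +i* nu)))%:E))
     <= gamma%:E)%E.

(** * The synthesis condition *)

(* Rows and columns are grouped in blocks of sizes n, n, p, q. *)
Definition Fmx (T : comNzRingType) n m p q (A : 'M[T]_n) (B1 : 'M[T]_(n, p))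
    (B2 : 'M[T]_(n, m)) (C1 : 'M[T]_(q, n)) (D11 : 'M[T]_(q, p))
    (D12 : 'M[T]_(q, m)) (P : 'M[T]_n) (Rm : 'M[T]_(m, n)) :
    'M[T]_(n + (n + (p + q))) :=
  let G := C1 *m P + D12 *m Rm in
  block_mx
    (- P) 0
    0     (block_mx
             (A *m P + B2 *m Rm + P *m A^T + Rm^T *m B2^T) (row_mx B1 G^T)
             (col_mx B1^T G)                (block_mx 0 D11^T
                                                      D11 0)).

(* diag(0, 0, I, I), with the block sizes of [Fmx]. *)
Definition Jmx (T : comNzRingType) n p q : 'M[T]_(n + (n + (p + q))) :=
  block_mx 0 0 0 (block_mx 0 0 0 1%:M).

(* Main.v *)
Require Import Defs.
From HB Require Import structures.
From mathcomp Require Import all_boot all_order all_algebra.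
From mathcomp Require Import complex mpoly.
From mathcomp Require Import classical_sets reals constructive_ereal ereal.

Set Implicit Arguments.
Unset Strict Implicit.
Unset Printing Implicit Defensive.

Import Order.TTheory GRing.Theory Num.Theory.

Local Open Scope ring_scope.
Local Open Scope complex_scope.
Local Open Scope sesquilinear_scope.

(** On the simplex, homogenization and multiplication by powers of
    [sum_i alpha_i] do not change values, so [F(alpha) - gamma J] is a sum of
    negative definite matrices weighted by monomials, all nonnegative and at
    least one positive.

    Since [A P + B2 R = (A + B2 K) P] and [C1 P + D12 R = (C1 + D12 K) P], the
    two diagonal blocks of [F(alpha) - gamma J] are the hypotheses of the bounded
    real lemma in terms of the inverse Lyapunov matrix [P].  Let
    [s = i nu], [s xi = A xi + B w], [y = C xi + D w] (closed-loop matrices).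
    The Hermitian form of the second block at
    [(P^-1 xi, w, gamma^-1 y)] equals [gamma^-1 |y|^2 - gamma |w|^2], because the
    terms in [A] and [B] add up to [(s + s^* ) x^* P x = 0] with [x = P^-1 xi].
    Hence [|y| < gamma |w|]. *)

(** * Hermitian forms of real symmetric matrices *)

Section Adjoint.
Variable (R : realType).
Local Notation C := R[i].

Lemma adjM m n k (X : 'M[C]_(m, n)) (Y : 'M[C]_(n, k)) :
  (X *m Y)^t* = Y^t* *m X^t*.
Proof. by rewrite trmx_mul map_mxM. Qed.

Lemma adjD m n (X Y : 'M[C]_(m, n)) : (X + Y)^t* = X^t* + Y^t*.
Proof. by rewrite linearD /= map_mxD. Qed.

Lemma adjZ m n z (X : 'M[C]_(m, n)) : (z *: X)^t* = z^* *: X^t*.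
Proof. by rewrite linearZ /= map_mxZ. Qed.

Lemma adj_mxC m n (M : 'M[R]_(m, n)) : (mxC M)^t* = mxC M^T.
Proof. by apply/matrixP => i j; rewrite !mxE; apply: conjc_real. Qed.

Lemma mxC_ReIm m n (X : 'M[C]_(m, n)) :
  X = mxC (map_mx (@complex.Re R) X) + 'i *: mxC (map_mx (@complex.Im R) X).
Proof. by apply/matrixP => i j; rewrite !mxE -complexE. Qed.

Lemma adj_ReIm m n (a b : 'M[R]_(m, n)) :
  (mxC a + 'i *: mxC b)^t* = mxC a^T - 'i *: mxC b^T.
Proof.
rewrite adjD adjZ !adj_mxC -scaleNr; congr (_ + _ *: _).
by apply/eqP; rewrite eq_complex /= oppr0 !eqxx.
Qed.

(** The cross terms carry the factors $i$ and $-i$; they cancel because symmetry of [M] gives $b^T M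
    a = a^T M b$. *)
Lemma quad_ReIm n (M : 'M[R]_n) (a b : 'cV[R]_n) : M^T = M ->
  ((mxC a + 'i *: mxC b)^t* *m mxC M *m (mxC a + 'i *: mxC b)) 0 0
  = ((a^T *m M *m a) 0 0 + (b^T *m M *m b) 0 0)%:C.
Proof.
move=> Msym.
have cross : b^T *m M *m a = a^T *m M *m b.
  have -> : a^T *m M *m b = (b^T *m M *m a)^T.
    by rewrite !trmx_mul trmxK Msym mulmxA.
  by apply/matrixP => i j; rewrite [RHS]mxE !ord1.
have ii : 'i * 'i = -1 :> C by rewrite -expr2 sqr_i.
rewrite adj_ReIm mulmxBl mulmxDr !mulmxBl -!scalemxAl -!scalemxAr !scalerA ii.
rewrite /mxC -!map_mxM cross scaleN1r /= addrAC opprK.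
rewrite ['i *: _ + _]addrC addrA addrK -map_mxD mxE.
by congr (_%:C); rewrite mxE.
Qed.

(** Real definiteness is transferred to complex vectors, as eigenvectors and frequency responses are
    complex. *)
Lemma negdef_quadC n (M : 'M[R]_n) (X : 'cV[C]_n) :
  negdef M -> X != 0 -> (X^t* *m mxC M *m X) 0 0 < 0.
Proof.
move=> [Msym Mneg] X0.
set a := map_mx (@complex.Re R) X; set b := map_mx (@complex.Im R) X.
have le0 (x : 'cV[R]_n) : (x^T *m M *m x) 0 0 <= 0.
  have [->|/Mneg/ltW//] := eqVneq x 0.
  by rewrite mulmx0 mxE.
rewrite [X]mxC_ReIm -/a -/b quad_ReIm // ltcR.
have [a0|/Mneg a0] := eqVneq a 0; last by rewrite ltr_wnDr.
have [b0|/Mneg b0] := eqVneq b 0; last by rewrite ltr_wnDl.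
by move: X0; rewrite [X]mxC_ReIm -/a -/b a0 b0 /mxC !map_mx0 scaler0 addr0 eqxx.
Qed.

Lemma negdef_unit n (M : 'M[R]_n) : negdef M -> M \in unitmx.
Proof.
move=> [_ Mneg]; rewrite -row_free_unit -kermx_eq0; apply/rowV0P => v /sub_kermxP vM.
apply/eqP/negPn/negP; rewrite -(inj_eq (@trmx_inj _ _ _)) trmx0 => /Mneg.
by rewrite trmxK vM mul0mx mxE ltxx.
Qed.

Lemma negdef_ulsub m n (A : 'M[R]_m) (B : 'M[R]_(m, n)) C D :
  negdef (block_mx A B C D) -> negdef A.
Proof.
move=> [sym neg]; split.
  by move: sym; rewrite tr_block_mx => /eq_block_mx[].
move=> x x0; have := neg (col_mx x 0).
rewrite col_mx_eq0 (negPf x0) tr_col_mx trmx0 mul_row_block mul_row_col.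
by rewrite mulmx0 addr0 mul0mx addr0 => /(_ isT).
Qed.

Lemma negdef_drsub m n (A : 'M[R]_m) (B : 'M[R]_(m, n)) C D :
  negdef (block_mx A B C D) -> negdef D.
Proof.
move=> [sym neg]; split.
  by move: sym; rewrite tr_block_mx => /eq_block_mx[].
move=> x x0; have := neg (col_mx 0 x).
rewrite col_mx_eq0 (negPf x0) andbF tr_col_mx trmx0 mul_row_block mul_row_col.
by rewrite mulmx0 add0r mul0mx add0r => /(_ isT).
Qed.

Lemma mul_adj_eq0 n (X : 'cV[C]_n) : ((X^t* *m X) 0 0 == 0) = (X == 0).
Proof.
apply/idP/eqP => [|->]; last by rewrite mulmx0 mxE.
rewrite mxE psumr_eq0 => [/allP h|i _]; last by rewrite !mxE mulrC mul_conjC_ge0.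
apply/matrixP => i j; rewrite ord1 !mxE; apply/eqP.
by have := h i (mem_index_enum _); rewrite !mxE mulrC mul_conjC_eq0.
Qed.

Lemma mul_adj_ge0 n (X : 'cV[C]_n) : 0 <= (X^t* *m X) 0 0.
Proof. by rewrite mxE sumr_ge0// => i _; rewrite !mxE mulrC mul_conjC_ge0. Qed.

End Adjoint.

(** * Lyapunov stability and the bounded real lemma *)

Section BoundedReal.
Variable (R : realType).
Local Notation C := R[i].

(** MathComp eigenvectors are row vectors: if $vA = zv$, then $v(AP+PA^T)v^* =
    2\,\mathrm{Re}(z)\,vPv^*$, where the left side is negative and $vPv^*$ is positive. *)
Lemma lyapunov_hurwitz n (A P : 'M[R]_n) :
  negdef (- P) -> negdef (A *m P + P *m A^T) -> hurwitz A.
Proof.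
move=> Pneg Lneg z /eigenvalueP[v vA v0].
have w0 : v^t* != 0.
  by rewrite map_mx_eq0 -trmx0 (inj_eq (@trmx_inj _ _ _)).
have Av : mxC A^T *m v^t* = z^* *: v^t* by rewrite -adj_mxC -adjM vA adjZ.
have := negdef_quadC Pneg w0; have := negdef_quadC Lneg w0.
rewrite trmxCK /mxC map_mxN map_mxD !map_mxM -/(mxC A) -/(mxC P) -/(mxC A^T).
rewrite mulmxN mulNmx [X in _ -> X < 0 -> _]mxE oppr_lt0.
rewrite mulmxDr mulmxDl mulmxA vA -!mulmxA Av -scalemxAl -!scalemxAr !mulmxA.
set p := (v *m _ *m _); rewrite -scalerDl mxE => lt0 p0.
rewrite pmulr_llt0 // in lt0.
case: z {vA Av} lt0 => x y; rewrite ltcE /= => /andP[_].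
by rewrite -mulr2n pmulrn_llt0.
Qed.

Lemma sigma_max_le q p (M : 'M[C]_(q, p)) (g : R) : 0 <= g ->
  (forall s, singular_value M s -> s <= g) -> sigma_max M <= g.
Proof.
move=> g0 h; rewrite /sigma_max.
(* The supremum of the empty set is 0, so this case rests on [0 <= g]. *)
have [->|/set0P ne] := eqVneq [set s | singular_value M s]%classic set0.
  by rewrite sup0.
by apply: ge_sup => // s; apply: h.
Qed.

(** For a row eigenvector [v] of $M^*M$ with eigenvalue $s^2$, the vector $w = v^*$ satisfies
    $|Mw|^2 = s^2|w|^2$. *)
Lemma singular_value_le q p (M : 'M[C]_(q, p)) (g : R) : 0 <= g ->
  (forall w : 'cV[C]_p, w != 0 ->
     ((M *m w)^t* *m (M *m w)) 0 0 <= (g ^+ 2)%:C * (w^t* *m w) 0 0) ->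
  forall s, singular_value M s -> s <= g.
Proof.
move=> g0 h s [s0 /eigenvalueP[v vM v0]].
have w0 : v^t* != 0.
  by rewrite map_mx_eq0 -trmx0 (inj_eq (@trmx_inj _ _ _)).
have := h _ w0.
have pos : 0 < (v^t*^t* *m v^t*) 0 0.
  by rewrite lt0r mul_adj_eq0 w0 mul_adj_ge0.
rewrite adjM trmxCK mulmxA -(mulmxA v) vM -scalemxAl mxE.
rewrite trmxCK in pos.
by rewrite ler_pM2r // lecR ler_pXn2r.
Qed.

Lemma bounded_real n p q (A P : 'M[R]_n) (B : 'M[R]_(n, p)) (Cm : 'M[R]_(q, n))
    (D : 'M[R]_(q, p)) (g : R) : 0 < g -> negdef (- P) ->
  negdef (block_mx (A *m P + P *m A^T) (row_mx B (Cm *m P)^T)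
                   (col_mx B^T (Cm *m P))
                   (block_mx (- g%:M) D^T D (- g%:M))) ->
  hinf_le (LTI A B Cm D) g.
Proof.
move=> g0 Pneg Nneg.
have hA : hurwitz A by apply: lyapunov_hurwitz Pneg (negdef_ulsub Nneg).
split=> //=; apply: ge_ereal_sup => _ [nu _ <-]; rewrite lee_fin.
apply: sigma_max_le (ltW g0) _; apply: singular_value_le (ltW g0) _ => w w0.
set s : C := 0 +i* nu.
have sN : s^* = - s by apply/eqP; rewrite eq_complex /= oppr0 !eqxx.
have Psym : P^T = P by apply: oppr_inj; case: Pneg => <- _; rewrite linearN.
(* A kernel vector would make [s] an eigenvalue of [A] with real part 0. Hence the [invmx] in
   [transfer] is a true inverse. *)
have Tu : s%:M - mxC A \in unitmx.
  rewrite -row_free_unit -kermx_eq0; apply/negPn/negP => /rowV0Pn[v].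
  move=> /sub_kermxP /eqP; rewrite mulmxBr mul_mx_scalar subr_eq0 eq_sym.
  move=> /eqP vA v0; suff /hA : eigenvalue (mxC A) s by rewrite ltxx.
  by apply/eigenvalueP; exists v.
have Pu : mxC P \in unitmx.
  by rewrite map_unitmx -[P]opprK -scaleN1r unitmxZ ?unitrN1 // negdef_unit.
set xi := invmx (s%:M - mxC A) *m (mxC B *m w).
set x := invmx (mxC P) *m xi.
have xiE : xi = mxC P *m x by rewrite /x mulKVmx.
have dyn : mxC A *m xi + mxC B *m w = s *: xi.
  have : (s%:M - mxC A) *m xi = mxC B *m w by rewrite /xi mulKVmx.
  by move=> <-; rewrite mulmxBl mul_scalar_mx addrC subrK.
set y := transfer _ _ *m w.
have yE : y = mxC Cm *m xi + mxC D *m w.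
  by rewrite /y /transfer /= mulmxDl !mulmxA.
have gC0 : g%:C != 0 by rewrite eq_complex /= gt_eqF.
(* This choice makes the last block row, $C_mPx + Dw - gu = y - gu$, vanish. *)
set u := g%:C^-1 *: y.
have X0 : col_mx x (col_mx w u) != 0.
  by rewrite !col_mx_eq0 (negPf w0) andbF.
clearbody y; move: xiE dyn yE X0; clearbody x; clearbody xi => xiE dyn yE X0.
have := negdef_quadC Nneg X0.
rewrite -mulmxA /mxC map_block_mx map_row_mx map_col_mx map_block_mx !map_mxN.
rewrite !map_scalar_mx map_mxD !map_mxM -!/(mxC _) /= mul_block_col mul_row_col.
rewrite mul_col_mx mul_block_col !mulNmx !mul_scalar_mx.
have -> : g%:C *: u = y by rewrite scalerA divff ?scale1r.
rewrite !tr_col_mx !map_row_mx add_col_mx !mul_row_col.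
have xiA : xi^t* = x^t* *m mxC P by rewrite xiE adjM adj_mxC Psym.
(* The adjoint of [dyn]; the sign comes from [sN], as [s] is purely imaginary. *)
have dynA : x^t* *m mxC P *m mxC A^T + w^t* *m mxC B^T = - s *: (x^t* *m mxC P).
  by rewrite -sN -xiA -!adj_mxC -adjM -adjM -adjD dyn adjZ.
have yA : x^t* *m mxC (Cm *m P)^T + w^t* *m mxC D^T = y^t*.
  by rewrite yE adjD !adjM !adj_mxC trmx_mul /mxC map_mxM xiA Psym mulmxA.
rewrite -[_ *m mxC P *m x]mulmxA -xiE (addrA (_ *m xi)) -yE subrr mulmx0 addr0.
(* [dyn] contributes $s\,x^*Px$ and [dynA] contributes $-s\,x^*Px$; what remains is $y^*u -
   g\,w^*w$. *)
rewrite mulmxDl -[_ *m mxC P *m x]mulmxA -xiE addrACA dyn !mulmxDr.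
rewrite [_ *m - _ + _]addrC -addrA (addrACA (_ *m _)) addrA !mulmxA.
rewrite (addrA (_ *m u) (_ *m u)).
rewrite -!mulmxDl dynA yA xiE -scalemxAr mulmxA -scalemxAl addrA scaleNr subrr.
rewrite add0r /u mulmxN -!scalemxAr.
move: (y^t* *m y) (w^t* *m w) => yy ww; rewrite !mxE subr_lt0.
by rewrite ltr_pdivrMl ?ltcR // mulrA -expr2 -rmorphXn => /ltW.
Qed.
End BoundedReal.

(** * Homogenization and negative definiteness on the simplex *)

Section Polya.
Variables (R : realType) (l : nat).
Implicit Types (p : {mpoly R[l]}) (a : 'I_l -> R).

Lemma meval_sumX a : simplex a -> (sumX R l).@[a] = 1.
Proof.
case=> a1 _; rewrite /sumX raddf_sum -[RHS]a1 /=.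
by apply: eq_bigr => i _; rewrite mevalXU.
Qed.

Lemma sumX_dhomog k : sumX R l ^+ k \is k.-homog.
Proof.
rewrite -[X in X.-homog]mul1n; apply: dhomogMn.
by apply: rpred_sum => i _; rewrite dhomogX /= mdeg1.
Qed.

Lemma meval_homogenize a d p : simplex a -> (homogenize d p).@[a] = p.@[a].
Proof.
move=> sa; rewrite [in RHS](mpolyE p) !raddf_sum /=; apply: eq_bigr => h _.
by rewrite !mevalZ rmorphM rmorphXn /= meval_sumX // expr1n mulr1.
Qed.

Lemma homogenize_dhomog d p : ((msize p).-1 <= d)%N -> homogenize d p \is d.-homog.
Proof.
move=> pd; rewrite /homogenize big_seq; apply: rpred_sum => h hp.
(* This bound makes the truncated subtraction in [homogenize] exact. *)
have hd : (mdeg h <= d)%N.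
  by apply: leq_trans pd; have := msize_mdeg_lt hp; case: (msize p).
apply: dhomogZ; rewrite -[X in X.-homog](subnKC hd); apply: dhomogM.
  by rewrite dhomogX.
exact: sumX_dhomog.
Qed.

Lemma msize_mxdeg m n (M : 'M[{mpoly R[l]}]_(m, n)) i j :
  ((msize (M i j)).-1 <= mxdeg M)%N.
Proof.
apply: leq_trans (leq_bigmax i); exact: (leq_bigmax (F := fun j => (msize (M i j)).-1)).
Qed.

Lemma simplex_pos a : simplex a -> exists i, 0 < a i.
Proof.
case=> a1 a0; have [i ai|none] := pickP (fun i => 0 < a i); first by exists i.
have := oner_neq0 R; rewrite -a1 big1 ?eqxx // => i _.
by apply/eqP; rewrite eq_le a0 andbT leNgt none.
Qed.

Lemma mxeval_dhomogE m n d (M : 'M[{mpoly R[l]}]_(m, n)) a : mxdhomog d M ->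
  mxeval a M = \sum_(g : 'X_{1..l < d.+1} | mdeg g == d)
                 (\prod_i a i ^+ g i) *: mxcoeff g M.
Proof.
move=> hM; apply/matrixP => i j; rewrite summxE mxE.
have sz : (msize (M i j) <= d.+1)%N.
  rewrite msizeE; apply/bigmax_leqP_seq => h hh _.
  by rewrite ltnS; move/dhomogP: (hM i j) => ->.
rewrite [M i j](mpolywE sz) raddf_sum /= [in RHS]big_mkcond /=.
apply: eq_bigr => g _; rewrite mevalZ mevalX !mxE mulrC.
(* Monomials of degree below [d] drop out by homogeneity. *)
by case: eqP => // /eqP gd; rewrite (dhomog_nemf_coeff (hM i j)) // mulr0.
Qed.

Lemma dhomog_negdef n d (M : 'M[{mpoly R[l]}]_n) a :
  mxdhomog d M -> (forall g, mdeg g = d -> negdef (mxcoeff g M)) ->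
  simplex a -> negdef (mxeval a M).
Proof.
move=> hM Mneg sa; rewrite (mxeval_dhomogE _ hM); split.
  rewrite raddf_sum /=; apply: eq_bigr => g /eqP /Mneg[sym _].
  by rewrite linearZ /= sym.
move=> x x0; have [i ai] := simplex_pos sa.
have [_ a0] := sa.
(* The strictly positive weight is that of $\alpha_i^d$ for a coordinate with $\alpha_i > 0$; its
   term is split off from the sum. *)
have dU : mdeg (U_(i) *+ d)%MM = d by rewrite mdegMn mdeg1 mul1n.
have lU : (mdeg (U_(i) *+ d)%MM < d.+1)%N by rewrite dU.
rewrite mulmx_sumr mulmx_suml summxE (bigD1 (BMultinom lU)) /= ?dU //.
have pos g : 0 <= \prod_i a i ^+ g i by apply: prodr_ge0 => k _; rewrite exprn_ge0.
apply: ltr_wnDr.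
  apply: sumr_le0 => g /andP[/eqP /Mneg[_ neg] _].
  rewrite -scalemxAr -scalemxAl mxE mulr_ge0_le0 //.
  by apply/ltW/neg.
have [_ neg] := Mneg _ dU.
rewrite -scalemxAr -scalemxAl mxE pmulr_rlt0; first exact: neg.
apply: prodr_gt0 => k _; rewrite mulmnE mnm1E.
by case: eqP => [<-|_]; rewrite ?mul1n ?mul0n ?expr0 // exprn_gt0.
Qed.

(** Multiplying the constant matrix [J] by [sumX] to the power [mxdeg F] gives it the degree of the
    homogenized [F], so the whole expression is homogeneous of degree [mxdeg F + e]. *)
Lemma polya_negdef n (F : 'M[{mpoly R[l]}]_n) (J : 'M[R]_n) c e a :
  (forall g : 'X_{1..l}, mdeg g = (mxdeg F + e)%N ->
     negdef (mxcoeff g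
       (sumX R l ^+ e *:
          (mxhomogenize (mxdeg F) F
           - (c%:MP * sumX R l ^+ mxdeg F) *: map_mx (@mpolyC l R) J)))) ->
  simplex a -> negdef (mxeval a F - c *: J).
Proof.
set M := _ *: _ => Mneg sa.
have -> : mxeval a F - c *: J = mxeval a M.
  apply/matrixP => i j; rewrite !mxE !(rmorphM, rmorphB, rmorphXn) /=.
  by rewrite meval_sumX // !expr1n mul1r meval_homogenize // !mevalC mulr1.
apply: dhomog_negdef Mneg sa => i j; rewrite !mxE addnC.
apply: dhomogM (sumX_dhomog _) _.
rewrite rpredB ?homogenize_dhomog ?msize_mxdeg //.
by rewrite mulrC !mul_mpolyC !dhomogZ // sumX_dhomog.
Qed.

End Polya.

(** * Evaluation of the synthesis matrix, and the state-feedback gain *)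

Lemma map_Jmx (T U : comNzRingType) (f : {rmorphism T -> U}) n p q :
  map_mx f (Jmx T n p q) = Jmx U n p q.
Proof. by rewrite /Jmx !map_block_mx !map_mx0 map_mx1. Qed.

Lemma map_Fmx (T U : comNzRingType) (f : {rmorphism T -> U}) n m p q
    (A : 'M[T]_n) (B1 : 'M[T]_(n, p)) (B2 : 'M[T]_(n, m)) (C1 : 'M[T]_(q, n))
    (D11 : 'M[T]_(q, p)) (D12 : 'M[T]_(q, m)) (P : 'M[T]_n) (K : 'M[T]_(m, n)) :
  map_mx f (Fmx A B1 B2 C1 D11 D12 P K) =
  Fmx (map_mx f A) (map_mx f B1) (map_mx f B2) (map_mx f C1) (map_mx f D11)
      (map_mx f D12) (map_mx f P) (map_mx f K).
Proof.
rewrite /Fmx !map_block_mx map_row_mx map_col_mx.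
by rewrite !(map_mxD, map_mxM, map_mxN, map_mx0, =^~ map_trmx).
Qed.

Theorem mainTheorem1 (R : realType) (l n m p q r : nat)
    (A : 'M[{mpoly R[l]}]_n) (B1 : 'M[{mpoly R[l]}]_(n, p))
    (B2 : 'M[{mpoly R[l]}]_(n, m)) (C1 : 'M[{mpoly R[l]}]_(q, n))
    (D11 : 'M[{mpoly R[l]}]_(q, p)) (D12 : 'M[{mpoly R[l]}]_(q, m))
    (C2 : 'M[{mpoly R[l]}]_(r, n)) (D21 : 'M[{mpoly R[l]}]_(r, p))
    (hA : mxhomog A) (hB1 : mxhomog B1) (hB2 : mxhomog B2)
    (hC1 : mxhomog C1) (hD11 : mxhomog D11) (hD12 : mxhomog D12)
    (hstab : forall a : 'I_l -> R, simplex a ->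
       stabilizable (mxeval a A) (mxeval a B2))
    (hdet : forall a : 'I_l -> R, simplex a ->
       detectable (mxeval a C2) (mxeval a A))
    (gamma : R) (hgamma : 0 < gamma)
    (dp dr : nat) (P : 'M[{mpoly R[l]}]_n) (Rm : 'M[{mpoly R[l]}]_(m, n))
    (hP : mxdhomog dp P)
    (hPsym : forall h : 'X_{1..l}, (mxcoeff h P)^T = mxcoeff h P)
    (hR : mxdhomog dr Rm) :
  let F := Fmx A B1 B2 C1 D11 D12 P Rm in
  let df := mxdeg F in
  (exists e : nat, forall g : 'X_{1..l}, mdeg g = (df + e)%N ->
     negdef (mxcoeff g
       (sumX R l ^+ e *:
          (mxhomogenize df F
           - (gamma%:MP * sumX R l ^+ df) *: Jmx _ n p q)))) ->
  forall a : 'I_l -> R, simplex a ->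
    negdef (mxeval a F - gamma *: Jmx R n p q) /\
    (mxeval a P \in unitmx /\
     hinf_le
       (closed_loop (mxeval a A) (mxeval a B1) (mxeval a B2) (mxeval a C1)
          (mxeval a D11) (mxeval a D12)
          (mxeval a Rm *m invmx (mxeval a P)))
       gamma).
Proof.
move=> F df [e Gneg] a sa.
have FJneg : negdef (mxeval a F - gamma *: Jmx R n p q).
  apply: (@polya_negdef _ _ _ F _ gamma e) sa => g /Gneg.
  (* The polynomial [Jmx] is the real one with its entries read as constants. *)
  by rewrite -(map_Jmx (@mpolyC l R)).
split=> //; move: FJneg; rewrite /F /mxeval map_Fmx -!/(mxeval a _).
set Aa := mxeval a A; set B1a := mxeval a B1; set B2a := mxeval a B2.
set C1a := mxeval a C1; set D11a := mxeval a D11; set D12a := mxeval a D12.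
set Pa := mxeval a P; set Ra := mxeval a Rm.
rewrite /Fmx /Jmx scale_block_mx opp_block_mx add_block_mx !(scaler0, oppr0, addr0).
move=> neg.
have Pneg := negdef_ulsub neg.
(* Negative definiteness of the first diagonal block, $-P$, makes the gain $RP^{-1}$ well
   defined. *)
have Pu : Pa \in unitmx.
  by rewrite -[Pa]opprK -scaleN1r unitmxZ ?unitrN1 // negdef_unit.
have Psym : Pa^T = Pa by apply: oppr_inj; case: Pneg => <- _; rewrite linearN.
split=> //; apply: bounded_real hgamma Pneg _.
have := negdef_drsub neg.
rewrite scale_block_mx opp_block_mx add_block_mx !(scaler0, oppr0, addr0).
have KP : Ra *m invmx Pa *m Pa = Ra by rewrite mulmxKV.
have -> : (Aa + B2a *m (Ra *m invmx Pa)) *m Pa = Aa *m Pa + B2a *m Ra.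
  by rewrite mulmxDl -mulmxA KP.
have -> : Pa *m (Aa + B2a *m (Ra *m invmx Pa))^T = Pa *m Aa^T + Ra^T *m B2a^T.
  by rewrite -{1}Psym -trmx_mul mulmxDl -mulmxA KP linearD /= !trmx_mul Psym.
have -> : (C1a + D12a *m (Ra *m invmx Pa)) *m Pa = C1a *m Pa + D12a *m Ra.
  by rewrite mulmxDl -mulmxA KP.
(* The single identity block of size [p + q] in [Jmx] is split into the two blocks $-\gamma I$
   expected by [bounded_real]. *)
by rewrite addrA scalemx1 scalar_mx_block opp_block_mx add_block_mx
  !(oppr0, addr0, add0r).
Qed.
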